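(* Let $\alpha\ge 0$. If $f\in\mathcal C_\alpha$ then: (a) the function $x\mapsto x^{\alpha+1}f(x)$ belongs to $\mathcal B_1$; (b) the function $x\mapsto 1/f(x)$ belongs to $\mathcal B_{\alpha+1}$; (c) the function $x\mapsto 1/(x^{\alpha+1}f(x))$ is completely monotonic.
   Context: A function $g:(0,\infty)\to\mathbb R$ is completely monotonic if it is infinitely often differentiable and $(-1)^n g^{(n)}(x)\ge 0$ for all $n=0,1,2,\ldots$ and all $x>0$. For $\lambda>0$, a $C^\infty$-function $f:(0,\infty)\to(0,\infty)$ belongs to the class $\mathcal B_\lambda$ of generalized Bernstein functions of order $\lambda$ if $x\mapsto x^{1-\lambda}f'(x)$ is completely monotonic. For $\alpha\ge 0$, a function $f:(0,\infty)\to(0,\infty)$ belongs to the class $\mathcal C_\alpha$ if $x^\alpha f(x)=\int_0^\infty e^{-xt}u(t)\,dt$ for all $x>0$, for some decreasing and logarithmically convex function $u:(0,\infty)\to(0,\infty)$ (logarithmically convex means that $\log u$ is convex; for positive decreasing $u$ the Laplace transform is defined on $(0,\infty)$ if and only if $\int_0^1u(t)\,dt<\infty$). *)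

(* Defs.v *)
From HB Require Import structures.
From mathcomp Require Import all_boot all_order all_algebra.
From mathcomp Require Import all_classical all_reals all_analysis.
Set Implicit Arguments.
Unset Strict Implicit.
Unset Printing Implicit Defensive.
Import Order.TTheory GRing.Theory Num.Theory.
Import numFieldNormedType.Exports.
Local Open Scope classical_set_scope.
Local Open Scope ring_scope.

(* A function on (0, oo) is represented by a total function R -> R.  Every      *)
(* predicate below depends only on its restriction to (0, oo): derivatives are  *)
(* taken at points x > 0 only, and thus involve only values close to x.         *)

Definition positive_on_pos (R : realType) (f : R -> R) : Prop :=
  forall x : R, 0 < x -> 0 < f x.

Definition smooth_on_pos (R : realType) (f : R -> R) : Prop :=
  forall (n : nat) (x : R), 0 < x -> derivable f^`(n)%classic x 1.

Definition completely_monotonic (R : realType) (g : R -> R) : Prop :=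
  smooth_on_pos g /\
  forall (n : nat) (x : R), 0 < x -> 0 <= (-1) ^+ n * g^`(n)%classic x.

(* The class B_lambda; it is meant for lambda > 0. *)
Definition generalized_Bernstein (R : realType) (lambda : R) (f : R -> R) :
    Prop :=
  [/\ positive_on_pos f,
      smooth_on_pos f &
      completely_monotonic (fun x : R => x `^ (1 - lambda) * f^`()%classic x)].

Definition laplace (R : realType) (u : R -> R) (x : R) : \bar R :=
  (\int[lebesgue_measure]_(t in `]0%R, +oo[%classic)
    (expR (- (x * t)) * u t)%:E)%E.

Definition log_convex_on_pos (R : realType) (u : R -> R) : Prop :=
  convex_function (`]0, +oo[%classic : set R) (fun t : R => ln (u t)).

(* The class C_alpha; it is meant for alpha >= 0.  "Decreasing" is understood   *)
(* in the wide sense.  The equation holds in \bar R, hence contains the         *)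
(* finiteness of the integral.                                                  *)
Definition class_C (R : realType) (alpha : R) (f : R -> R) : Prop :=
  positive_on_pos f /\
  exists u : R -> R,
    [/\ positive_on_pos u,
        {in `]0, +oo[ &, nonincreasing_fun u},
        log_convex_on_pos u &
        forall x : R, 0 < x -> (x `^ alpha * f x)%:E = laplace u x].

(* Main.v *)
Require Import Defs.
From mathcomp Require Import all_boot all_order all_algebra.
From mathcomp Require Import all_classical all_reals all_analysis.
From mathcomp Require Import measurable_realfun lebesgue_integral_under.
From mathcomp Require Import ring.
Import Order.TTheory GRing.Theory Num.Theory.
Import numFieldNormedType.Exports.
Local Open Scope classical_set_scope.
Local Open Scope ring_scope.

(** Let [g x = x `^ alpha * f x] be the Laplace transform of the positive,
    decreasing and log-convex function [u]. All three claims follow from two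
    inequalities between the numbers

      [m_n = \int t ^ n / n! * expR (- (x * t)) * u t dt]

    at one fixed [x > 0]. Differentiation under the integral sign
    ([is_derive_moment]) shows that [m_n] is the coefficient of [s ^ n] in the
    Taylor expansion of [s |-> g (x - s)]. In terms of such coefficients
    ([tcoef]), a smooth function is completely monotonic when all of them are
    nonnegative ([completely_monotonicP]), it has a completely monotonic
    derivative when all of them but the first are nonpositive, and products of
    functions become products of power series ([tcoefM]).

    (a) The function [x ^ (alpha + 1) * f x = x * g x] has the coefficients
    [x * m_n.+1 - m_n] after the first one. They are nonpositive because [u] is
    decreasing ([moment_decreasing]).

    (c) The reciprocal of a power series whose coefficients, apart from a
    positive first one, are nonpositive has nonnegative coefficients
    ([conv_inverse_ge0]). With (a) this makes [1 / (x * g x)] completely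
    monotonic.

    (b) On the half-line
    [x ^ (- alpha) * (1 / f)' = alpha * (1 / (x * g x)) + (1 / g)'], so by (c) it
    remains to see that [1 / g] has a completely monotonic derivative. By Kaluza's
    theorem ([conv_inverse_log_convex_le0]) this holds as soon as the sequence
    [m_n] is log-convex. For an exponential [u] it is geometric. In general, [u]
    is compared with an exponential: the logarithm of [u] is convex and that of
    the exponential is affine, so their difference changes sign at most twice,
    and integrating it against a polynomial with the same sign changes gives the
    inequality ([moment_log_convex]). *)

Local Notation half_line R := (`]0%R, +oo[%classic : set R).

(** * Reciprocals of power series *)

(** Solving the convolution identity for [b n] expresses it through earlier
    entries with the nonnegative weights [- a k / a 0]. *)
Lemma conv_inverse_ge0 {R : realFieldType} (a b : nat -> R) :
  0 < a 0%N -> (forall n, a n.+1 <= 0) ->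
  (forall n, \sum_(k < n.+1) a k * b (n - k)%N = (n == 0%N)%:R) ->
  forall n, 0 <= b n.
Proof.
move=> a0 aN ab; elim/ltn_ind => n IHn.
rewrite -(pmulr_rge0 _ a0).
have := ab n; rewrite big_ord_recl subn0 => /(canRL (addrK _)) ->.
rewrite subr_ge0 (le_trans _ (ler0n _ _))//; apply: sumr_le0 => k _.
apply: mulr_le0_ge0; first exact: aN.
by apply: IHn; case: (n) k => [[]|m k] //; rewrite ltn_subrL.
Qed.

(** Log-convexity says that [a k.+1 / a k] is nondecreasing in [k]. *)
Lemma log_convex_seq_ratio {R : realFieldType} (a : nat -> R) :
  (forall n, 0 < a n) -> (forall n, a n.+1 ^+ 2 <= a n * a n.+2) ->
  forall k n, (k <= n)%N -> a k.+1 * a n <= a k * a n.+1.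
Proof.
move=> a_gt0 alc k; elim=> [|n IHn].
  by rewrite leqn0 => /eqP ->; rewrite mulrC.
rewrite leq_eqVlt => /predU1P[->|]; first by rewrite mulrC.
rewrite ltnS => /IHn {}IHn.
rewrite -(ler_pM2r (a_gt0 n)) mulrAC.
apply: (le_trans (ler_wpM2r (ltW (a_gt0 n.+1)) IHn)).
rewrite -!mulrA ler_pM2l// (mulrC _ (a n)) -expr2; exact: alc.
Qed.

(** Kaluza's theorem: the reciprocal of a power series with log-convex
    coefficients has nonpositive coefficients after the constant one. Comparing
    the convolution identity at [n.+1] with [a n.+1 / a n] times the identity at
    [n] leaves only terms of known sign. *)
Lemma conv_inverse_log_convex_le0 {R : realFieldType} (a b : nat -> R) :
  (forall n, 0 < a n) -> (forall n, a n.+1 ^+ 2 <= a n * a n.+2) ->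
  (forall n, \sum_(k < n.+1) a k * b (n - k)%N = (n == 0%N)%:R) ->
  forall n, b n.+1 <= 0.
Proof.
move=> a_gt0 alc ab; elim/ltn_ind => n IHn.
have := ab n.+1; rewrite big_ord_recl subn0 => /eqP; rewrite addr_eq0 => /eqP E.
rewrite -(pmulr_rle0 _ (a_gt0 0%N)) E oppr_le0.
(* In the sum, [b] is weighted by [a k.+1] instead of [a k]; the ratio of these
   weights is at most the last one, [a n.+1 / a n], and only the term [k = n],
   where that bound is attained, has a positive [b]. *)
apply: (@le_trans _ _ (a n.+1 / a n * \sum_(k < n.+1) a k * b (n - k)%N)).
  by rewrite ab mulr_ge0// divr_ge0 ?ltW.
rewrite mulr_sumr; apply: ler_sum => k _ /=.
rewrite /bump /= add1n subSS.
have /predU1P[->|kn] : (k == n :> nat) || (k < n)%N by rewrite -leq_eqVlt -ltnS.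
  by rewrite mulrA divfK ?gt_eqF.
rewrite mulrA ler_wnM2r//.
  rewrite -[(n - k)%N]prednK ?subn_gt0//; apply: IHn.
  by rewrite prednK ?subn_gt0// leq_subr.
rewrite mulrAC ler_pdivlMr// [leRHS]mulrC.
exact/log_convex_seq_ratio/ltnW.
Qed.

(** * Smooth functions on the open half-line *)

Lemma near_eq_on_pos {R : realType} (f g : R -> R) (x : R) :
  (forall y : R, 0 < y -> f y = g y) -> 0 < x -> \forall y \near x, f y = g y.
Proof.
move=> fg x0; near=> y; apply: fg.
by near: y; exact: lt_nbhsr.
Unshelve. end_near. Qed.

Lemma eq_derive1_on_pos {R : realType} (f g : R -> R) :
  (forall x : R, 0 < x -> f x = g x) ->
  forall x : R, 0 < x -> f^`()%classic x = g^`()%classic x.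
Proof.
move=> fg x x0; rewrite !derive1E; apply: near_eq_derive; exact: near_eq_on_pos.
Qed.

Lemma eq_derive1n_on_pos {R : realType} (f g : R -> R) n :
  (forall x : R, 0 < x -> f x = g x) ->
  forall x : R, 0 < x -> f^`(n)%classic x = g^`(n)%classic x.
Proof.
move=> fg; elim: n => [|n IHn] x x0; first exact: fg.
by rewrite !derive1nS; exact: eq_derive1_on_pos.
Qed.

(** Finite orders of differentiability make closure under products and inverses
    provable by induction: the derivative of [f^-1] involves [f^-1] again, but
    one order lower is enough for it. *)
Definition smooth_upto {R : realType} (n : nat) (f : R -> R) :=
  forall k (x : R), (k <= n)%N -> 0 < x -> derivable f^`(k)%classic x 1.

Lemma smooth_onP {R : realType} (f : R -> R) :
  smooth_on_pos f <-> forall n, smooth_upto n f.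
Proof.
by split=> [sf n k x _|sf n x]; [exact: sf | exact: (sf n)].
Qed.

Lemma eq_smooth_upto {R : realType} n (f g : R -> R) :
  (forall x : R, 0 < x -> f x = g x) -> smooth_upto n f -> smooth_upto n g.
Proof.
move=> fg sf k x kn x0; apply: near_eq_derivable (sf k x kn x0).
by apply: near_eq_on_pos => // y y0; exact: eq_derive1n_on_pos.
Qed.

Lemma eq_smooth_on_pos {R : realType} (f g : R -> R) :
  (forall x : R, 0 < x -> f x = g x) -> smooth_on_pos f -> smooth_on_pos g.
Proof.
by move=> fg /smooth_onP sf; apply/smooth_onP => n; exact: eq_smooth_upto (sf n).
Qed.

(** The inductive step of all the closure proofs: it suffices to exhibit a
    derivative on the half-line. *)
Lemma smooth_uptoS {R : realType} n (f df : R -> R) :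
  (forall x : R, 0 < x -> is_derive x 1 f (df x)) ->
  smooth_upto n df -> smooth_upto n.+1 f.
Proof.
move=> fdf sf [x _ x0|k x kn x0]; first by have [] := fdf x x0.
rewrite derive1Sn; apply: (eq_smooth_upto n df) => // y y0.
by rewrite derive1E; have [_ ->] := fdf y y0.
Qed.

Lemma smooth_upto_is_derive {R : realType} n (f : R -> R) :
  smooth_upto n f -> forall x : R, 0 < x -> is_derive x 1 f (f^`()%classic x).
Proof.
by move=> sf x x0; apply: DeriveDef; [exact: (sf 0%N) | rewrite derive1E].
Qed.

Lemma smooth_upto_derive1 {R : realType} n (f : R -> R) :
  smooth_upto n.+1 f -> smooth_upto n f^`()%classic.
Proof. by move=> sf k x kn x0; rewrite -derive1Sn; exact: sf. Qed.

Lemma smooth_uptoW {R : realType} n (f : R -> R) :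
  smooth_upto n.+1 f -> smooth_upto n f.
Proof. by move=> sf k x kn; apply: sf; exact: leqW. Qed.

Lemma smooth_upto_cst {R : realType} n (c : R) : smooth_upto n (fun=> c).
Proof.
elim: n c => [|n IHn] c.
  by case=> // x _ _; exact: derivable_cst.
refine (smooth_uptoS n _ (fun=> 0) _ (IHn 0)) => x _; exact: is_derive_cst.
Qed.

Lemma smooth_uptoD {R : realType} n (f g : R -> R) :
  smooth_upto n f -> smooth_upto n g -> smooth_upto n (fun x => f x + g x).
Proof.
elim: n f g => [|n IHn] f g sf sg.
  by case=> // x _ x0; apply: derivableD; [exact: (sf 0%N)|exact: (sg 0%N)].
refine (smooth_uptoS n _ (fun x => f^`()%classic x + g^`()%classic x) _ _).
  move=> x x0; have df := smooth_upto_is_derive _ _ sf _ x0.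
  have dg := smooth_upto_is_derive _ _ sg _ x0.
  exact: is_deriveD.
by apply: IHn; exact: smooth_upto_derive1.
Qed.

Lemma smooth_uptoM {R : realType} n (f g : R -> R) :
  smooth_upto n f -> smooth_upto n g -> smooth_upto n (fun x => f x * g x).
Proof.
elim: n f g => [|n IHn] f g sf sg.
  by case=> // x _ x0; apply: derivableM; [exact: (sf 0%N)|exact: (sg 0%N)].
refine (smooth_uptoS n _
  (fun x => f^`()%classic x * g x + f x * g^`()%classic x) _ _).
  move=> x x0; have df := smooth_upto_is_derive _ _ sf _ x0.
  have dg := smooth_upto_is_derive _ _ sg _ x0.
  suff <- : f x *: g^`()%classic x + g x *: f^`()%classic x =
            f^`()%classic x * g x + f x * g^`()%classic x by exact: is_deriveM.
  by rewrite addrC /GRing.scale/= mulrC.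
have [sfW sgW] := (smooth_uptoW _ _ sf, smooth_uptoW _ _ sg).
have [sf' sg'] := (smooth_upto_derive1 _ _ sf, smooth_upto_derive1 _ _ sg).
exact: (smooth_uptoD _ _ _ (IHn _ _ sf' sgW) (IHn _ _ sfW sg')).
Qed.

Lemma smooth_uptoV {R : realType} n (f : R -> R) :
  (forall x : R, 0 < x -> f x != 0) -> smooth_upto n f ->
  smooth_upto n (fun x => (f x)^-1).
Proof.
move=> f0; elim: n => [|n IHn] sf.
  by case=> // x _ x0; apply: derivableV; [exact: f0|exact: (sf 0%N)].
refine (smooth_uptoS n _
  (fun x => (-1) * (f^`()%classic x * ((f x)^-1 * (f x)^-1))) _ _).
  move=> x x0; have df := smooth_upto_is_derive _ _ sf _ x0.
  suff <- : - (f x) ^- 2 *: f^`()%classic x =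
            (-1) * (f^`()%classic x * ((f x)^-1 * (f x)^-1)).
    exact: (is_deriveV (f0 x x0)).
  by rewrite /GRing.scale/= -exprVn expr2; ring.
have sV := IHn (smooth_uptoW _ _ sf).
apply: smooth_uptoM; first exact: smooth_upto_cst.
by apply: smooth_uptoM; [exact: smooth_upto_derive1 | exact: smooth_uptoM].
Qed.

Lemma smooth_upto_powR {R : realType} n (a : R) : smooth_upto n (fun x => x `^ a).
Proof.
elim: n a => [|n IHn] a.
  by case=> // x _ x0; have [] := is_derive1_powR a x0.
refine (smooth_uptoS n _ (fun x => a * x `^ (a - 1)) (@is_derive1_powR _ a) _).
by apply: smooth_uptoM; [exact: smooth_upto_cst | exact: IHn].
Qed.

Lemma smooth_on_pos_derive1 {R : realType} (f : R -> R) :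
  smooth_on_pos f -> smooth_on_pos f^`()%classic.
Proof. by move=> sf n x x0; rewrite -derive1Sn; exact: sf. Qed.

Lemma smooth_on_posM {R : realType} (f g : R -> R) :
  smooth_on_pos f -> smooth_on_pos g -> smooth_on_pos (fun x => f x * g x).
Proof.
by move=> /smooth_onP sf /smooth_onP sg; apply/smooth_onP => n; exact: smooth_uptoM.
Qed.

Lemma smooth_on_posD {R : realType} (f g : R -> R) :
  smooth_on_pos f -> smooth_on_pos g -> smooth_on_pos (fun x => f x + g x).
Proof.
by move=> /smooth_onP sf /smooth_onP sg; apply/smooth_onP => n; exact: smooth_uptoD.
Qed.

Lemma smooth_on_posV {R : realType} (f : R -> R) :
  (forall x : R, 0 < x -> f x != 0) -> smooth_on_pos f ->
  smooth_on_pos (fun x => (f x)^-1).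
Proof.
by move=> f0 /smooth_onP sf; apply/smooth_onP => n; exact: smooth_uptoV.
Qed.

Lemma smooth_on_pos_cst {R : realType} (c : R) : smooth_on_pos (fun=> c).
Proof. by apply/smooth_onP => n; exact: smooth_upto_cst. Qed.

Lemma smooth_on_pos_powR {R : realType} (a : R) : smooth_on_pos (fun x => x `^ a).
Proof. by apply/smooth_onP => n; exact: smooth_upto_powR. Qed.

(** * Taylor coefficients and complete monotonicity *)

Lemma factSr {R : realType} n : n.+1`!%:R = n.+1%:R * n`!%:R :> R.
Proof. by rewrite factS natrM. Qed.

Lemma fact_neq0 {R : realType} n : n`!%:R != 0 :> R.
Proof. by rewrite pnatr_eq0 -lt0n fact_gt0. Qed.

(** The coefficient of [s ^+ n] in the Taylor expansion of [s |-> f (x - s)].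
    Expanding backwards removes the alternating signs, so that complete
    monotonicity becomes nonnegativity; dividing by the factorial turns the
    Leibniz formula into a plain convolution. *)
Definition tcoef {R : realType} (f : R -> R) (n : nat) (x : R) : R :=
  (-1) ^+ n * f^`(n)%classic x / n`!%:R.

Lemma tcoef0 {R : realType} (f : R -> R) (x : R) : tcoef f 0 x = f x.
Proof. by rewrite /tcoef expr0 mul1r fact0 divr1. Qed.

Lemma tcoefS {R : realType} (f : R -> R) n (x : R) :
  n.+1%:R * tcoef f n.+1 x = - tcoef f^`()%classic n x.
Proof.
rewrite /tcoef derive1Sn factS natrM exprS; field.
by rewrite nat1r !pnatr_eq0 -!lt0n fact_gt0.
Qed.

Lemma eq_tcoef {R : realType} (f g : R -> R) :
  (forall x : R, 0 < x -> f x = g x) ->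
  forall n (x : R), 0 < x -> tcoef f n x = tcoef g n x.
Proof. by move=> fg n x x0; rewrite /tcoef (eq_derive1n_on_pos _ _ n fg). Qed.

Lemma tcoef_cst0 {R : realType} n (x : R) : tcoef (fun=> 0 : R) n x = 0.
Proof.
suff E : ((fun=> 0) : R -> R)^`(n)%classic = fun=> 0.
  by rewrite /tcoef E mulr0 mul0r.
elim: n => // n IHn; rewrite derive1nS IHn; apply/funext => y.
by rewrite derive1_cst.
Qed.

Lemma tcoef_cst {R : realType} (a : R) n (x : R) :
  tcoef (fun=> a) n x = a * (n == 0%N)%:R.
Proof.
case: n => [|n]; first by rewrite tcoef0 mulr1.
apply: (@mulfI _ n.+1%:R); first by rewrite pnatr_eq0.
rewrite tcoefS !mulr0 (_ : ((fun=> a) : R -> R)^`()%classic = fun=> 0).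
  by rewrite tcoef_cst0 oppr0.
by apply/funext => y; rewrite derive1_cst.
Qed.

Lemma completely_monotonicP {R : realType} (f : R -> R) :
  completely_monotonic f <->
  smooth_on_pos f /\ forall n (x : R), 0 < x -> 0 <= tcoef f n x.
Proof.
have E n (x : R) : (0 <= tcoef f n x) = (0 <= (-1) ^+ n * f^`(n)%classic x).
  by rewrite /tcoef pmulr_lge0// invr_gt0 ltr0n fact_gt0.
by split=> -[sf cf]; split=> // n x x0; move: (cf n x x0); rewrite E.
Qed.

Lemma tcoefD {R : realType} (f g : R -> R) n (x : R) :
  smooth_on_pos f -> smooth_on_pos g -> 0 < x ->
  tcoef (fun y => f y + g y) n x = tcoef f n x + tcoef g n x.
Proof.
elim: n f g => [|n IHn] f g sf sg x0; first by rewrite !tcoef0.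
have [sf' sg'] := (smooth_on_pos_derive1 _ sf, smooth_on_pos_derive1 _ sg).
apply: (@mulfI _ n.+1%:R); first by rewrite pnatr_eq0.
transitivity (- (tcoef f^`()%classic n x + tcoef g^`()%classic n x)); last first.
  by rewrite opprD mulrDr; congr (_ + _); exact/esym/tcoefS.
apply: (etrans (tcoefS _ _ _)).
rewrite -(IHn _ _ sf' sg' x0); congr (- _); apply: eq_tcoef => // y y0.
by rewrite !derive1E deriveD//; [exact: (sf 0%N)|exact: (sg 0%N)].
Qed.

(** The Leibniz formula, in the form of a product of power series. *)
Lemma tcoefM {R : realType} (f g : R -> R) n (x : R) :
  smooth_on_pos f -> smooth_on_pos g -> 0 < x ->
  tcoef (fun y => f y * g y) n x =
  \sum_(k < n.+1) tcoef f k x * tcoef g (n - k) x.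
Proof.
elim: n f g => [|n IHn] f g sf sg x0; first by rewrite big_ord1 !tcoef0.
have [sf' sg'] := (smooth_on_pos_derive1 _ sf, smooth_on_pos_derive1 _ sg).
apply: (@mulfI _ n.+1%:R); first by rewrite pnatr_eq0.
rewrite (tcoefS (fun y => f y * g y)) (@eq_tcoef _ _
  (fun y => f^`()%classic y * g y + f y * g^`()%classic y))//; last first.
  move=> y y0; rewrite !derive1E deriveM; [|exact: (sf 0%N)|exact: (sg 0%N)].
  by rewrite addrC; congr (_ + _); rewrite /GRing.scale/= mulrC.
rewrite (tcoefD _ _ n x (smooth_on_posM _ _ sf' sg) (smooth_on_posM _ _ sf sg') x0).
rewrite (IHn _ _ sf' sg x0) (IHn _ _ sf sg' x0) opprD -!sumrN mulr_sumr.
(* The weight [n.+1] splits as [k + (n.+1 - k)]: each half is the contribution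
   of one of the two terms of the product rule. *)
pose F k := k%:R * tcoef f k x * tcoef g (n.+1 - k) x.
pose G k := (n.+1 - k)%:R * tcoef f k x * tcoef g (n.+1 - k) x.
transitivity (\sum_(k < n.+2) F k + \sum_(k < n.+2) G k).
  congr (_ + _).
    rewrite [RHS]big_ord_recl /F !mul0r add0r; apply: eq_bigr => k _.
    by rewrite -mulNr -(tcoefS f) lift0 subSS.
  rewrite [RHS]big_ord_recr/= /G subnn !mul0r addr0; apply: eq_bigr => k _.
  by rewrite subSn ?leq_ord// [RHS]mulrAC (tcoefS g) mulNr mulrC.
rewrite -big_split; apply: eq_bigr => k _.
rewrite /F /G; move: (tcoef f k x) (tcoef g _ x) => a b.
by rewrite /= mulrA -!mulrDl -natrD subnKC// leq_ord.
Qed.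

Lemma tcoef_derive1_ge0 {R : realType} (f : R -> R) n (x : R) :
  (0 <= tcoef f^`()%classic n x) = (tcoef f n.+1 x <= 0).
Proof. by rewrite -[tcoef f^`()%classic n x]opprK -tcoefS oppr_ge0 pmulr_rle0. Qed.

(** This reduces statements on the derivatives of [1 / f] to the algebra of
    reciprocal power series. *)
Lemma tcoef_inverse_conv {R : realType} (f : R -> R) n (x : R) :
  smooth_on_pos f -> (forall y : R, 0 < y -> f y != 0) -> 0 < x ->
  \sum_(k < n.+1) tcoef f k x * tcoef (fun y => (f y)^-1) (n - k) x =
  (n == 0%N)%:R.
Proof.
move=> sf f0 x0; rewrite -(tcoefM _ _ n x sf (smooth_on_posV _ f0 sf) x0).
rewrite (@eq_tcoef _ _ (fun=> 1))//; last by move=> y y0; rewrite mulfV// f0.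
by rewrite tcoef_cst mul1r.
Qed.

(** A family [D] that differentiates like the Taylor coefficients of [D 0] is the
    family of these coefficients, and its existence proves smoothness. *)
Lemma tcoef_of_tower {R : realType} (f : R -> R) (D : nat -> R -> R) :
  (forall x : R, 0 < x -> f x = D 0%N x) ->
  (forall n (x : R), 0 < x -> is_derive x 1 (D n) (- (n.+1%:R * D n.+1 x))) ->
  smooth_on_pos f /\ forall n (x : R), 0 < x -> tcoef f n x = D n x.
Proof.
move=> fD dD.
have fDn n (x : R) : 0 < x -> f^`(n)%classic x = (-1) ^+ n * n`!%:R * D n x.
  elim: n x => [|n IHn] x x0; first by rewrite expr0 fact0 !mul1r; exact: fD.
  rewrite derive1nS derive1E (near_eq_derive _ (near_eq_on_pos _ _ _ IHn x0)).
  have dDn := dD n x x0.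
  have [_ ->] := is_deriveZ ((-1) ^+ n * n`!%:R) dDn.
  by rewrite /GRing.scale/= factSr exprS; ring.
split=> [n x x0|n x x0].
  have dDn := dD n x x0.
  have dZ := is_deriveZ ((-1) ^+ n * n`!%:R) dDn.
  apply: near_eq_derivable (@ex_derive _ _ _ _ _ _ _ dZ).
  by apply: near_eq_on_pos => // y y0; rewrite fDn.
by rewrite /tcoef fDn// !mulrA -expr2 sqrr_sign mul1r mulrC mulrA
  mulVf ?mul1r ?fact_neq0.
Qed.

(** In the variable [s] of the expansion the factor is [x - s], so that
    multiplying by it subtracts the shifted coefficients from the scaled ones. *)
Lemma tcoef_mulx_tower {R : realType} (D : nat -> R -> R) :
  (forall n (x : R), 0 < x -> is_derive x 1 (D n) (- (n.+1%:R * D n.+1 x))) ->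
  smooth_on_pos (fun x => x * D 0%N x) /\
  forall n (x : R), 0 < x ->
    tcoef (fun x => x * D 0%N x) n.+1 x = x * D n.+1 x - D n x.
Proof.
move=> dD.
pose E n x := if n is k.+1 then x * D k.+1 x - D k x else x * D 0%N x.
have dxD n (x : R) : 0 < x ->
    is_derive x 1 (fun y => y * D n y) (D n x - n.+1%:R * (x * D n.+1 x)).
  move=> x0; have dDn := dD n x x0.
  suff <- : x *: (- (n.+1%:R * D n.+1 x)) + D n x *: (1 : R) =
            D n x - n.+1%:R * (x * D n.+1 x).
    exact: (@is_deriveM _ _ id (D n) x 1 1 _ _ dDn).
  by rewrite /GRing.scale/=; ring.
have [] := tcoef_of_tower (fun x => x * D 0%N x) E.
- by [].
- case=> [|n] x x0.
    suff -> : - (1%:R * E 1%N x) = D 0%N x - 1%:R * (x * D 1%N x) by exact: dxD.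
    by rewrite /E; ring.
  suff -> : - (n.+2%:R * E n.+2 x) =
      (D n.+1 x - n.+2%:R * (x * D n.+2 x)) - (- (n.+1%:R * D n.+1 x)).
    have d1 := dxD n.+1 x x0; have d2 := dD n x x0.
    exact: is_deriveB.
  by rewrite /E -!nat1r; ring.
by move=> sE tE; split=> // n x x0; rewrite tE.
Qed.

Lemma eq_completely_monotonic {R : realType} (f g : R -> R) :
  (forall x : R, 0 < x -> f x = g x) ->
  completely_monotonic f -> completely_monotonic g.
Proof.
move=> fg [sf cf]; split; first exact: (eq_smooth_on_pos _ _ fg sf).
by move=> n x x0; rewrite -(eq_derive1n_on_pos _ _ n fg)// cf.
Qed.

Lemma completely_monotonic_cst {R : realType} (a : R) :
  0 <= a -> completely_monotonic (fun=> a).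
Proof.
move=> a0; apply/completely_monotonicP; split; first exact: smooth_on_pos_cst.
by move=> n x _; rewrite tcoef_cst mulr_ge0.
Qed.

Lemma completely_monotonicD {R : realType} (f g : R -> R) :
  completely_monotonic f -> completely_monotonic g ->
  completely_monotonic (fun x => f x + g x).
Proof.
move=> /completely_monotonicP[sf cf] /completely_monotonicP[sg cg].
apply/completely_monotonicP; split; first exact: (smooth_on_posD _ _ sf sg).
by move=> n x x0; rewrite (tcoefD _ _ n x sf sg x0) addr_ge0 ?cf ?cg.
Qed.

Lemma completely_monotonicM {R : realType} (f g : R -> R) :
  completely_monotonic f -> completely_monotonic g ->
  completely_monotonic (fun x => f x * g x).
Proof.
move=> /completely_monotonicP[sf cf] /completely_monotonicP[sg cg].
apply/completely_monotonicP; split; first exact: (smooth_on_posM _ _ sf sg).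
move=> n x x0; rewrite (tcoefM _ _ n x sf sg x0); apply: sumr_ge0 => k _.
exact: mulr_ge0 (cf _ _ x0) (cg _ _ x0).
Qed.

(** The derivative shifts the coefficients by one and changes their sign. *)
Lemma completely_monotonic_derive1P {R : realType} (f : R -> R) :
  smooth_on_pos f -> (forall n (x : R), 0 < x -> tcoef f n.+1 x <= 0) ->
  completely_monotonic f^`()%classic.
Proof.
move=> sf cf; apply/completely_monotonicP; split.
  exact: (smooth_on_pos_derive1 _ sf).
by move=> n x x0; rewrite tcoef_derive1_ge0 cf.
Qed.

(** The reciprocal of a Bernstein function is completely monotonic. *)
Lemma completely_monotonic_inverse {R : realType} (f : R -> R) :
  positive_on_pos f -> smooth_on_pos f ->
  (forall n (x : R), 0 < x -> tcoef f n.+1 x <= 0) ->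
  completely_monotonic (fun x => (f x)^-1).
Proof.
move=> f0 sf fN.
have fn0 (x : R) : 0 < x -> f x != 0 by move=> x0; rewrite gt_eqF// f0.
apply/completely_monotonicP; split; first exact: (smooth_on_posV _ fn0 sf).
move=> n x x0.
apply: (conv_inverse_ge0 (fun k => tcoef f k x)
  (fun k => tcoef (fun y => (f y)^-1) k x)) => [||m].
- by rewrite tcoef0 f0.
- by move=> m; exact: fN.
- exact: (tcoef_inverse_conv _ m x sf fn0 x0).
Qed.

(** Kaluza's theorem at the point [x]; applied at every [x], it says that [1 / f]
    has a completely monotonic derivative. *)
Lemma tcoef_inverse_log_convex_le0 {R : realType} (f : R -> R) n (x : R) :
  positive_on_pos f -> smooth_on_pos f -> 0 < x ->
  (forall k, 0 < tcoef f k x) ->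
  (forall k, tcoef f k.+1 x ^+ 2 <= tcoef f k x * tcoef f k.+2 x) ->
  tcoef (fun y => (f y)^-1) n.+1 x <= 0.
Proof.
move=> f0 sf x0 a_gt0 alc.
have fn0 (y : R) : 0 < y -> f y != 0 by move=> y0; rewrite gt_eqF// f0.
apply: (conv_inverse_log_convex_le0 (fun k => tcoef f k x)
  (fun k => tcoef (fun y => (f y)^-1) k x)) => // m.
exact: (tcoef_inverse_conv _ m x sf fn0 x0).
Qed.

(** * Moments of exponentially damped functions *)

Lemma integrable_EFinZl {d : measure_display} {T : measurableType d}
    {R : realType} (mu : {measure set T -> \bar R}) (D : set T) (r : R)
    (f : T -> R) :
  measurable D -> mu.-integrable D (EFin \o f) ->
  mu.-integrable D (EFin \o (fun t => r * f t)).
Proof.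
move=> mD iF; have := integrableZl mD r iF.
rewrite (_ : (fun t => _) = EFin \o (fun t => r * f t)); first by apply.
by apply/funext => t; rewrite /= EFinM.
Qed.

(** With the factorial included, the moments of a damped function are exactly the
    Taylor coefficients of its Laplace transform. *)
Definition moment_integrand {R : realType} (w : R -> R) (n : nat) (t : R) : R :=
  t ^+ n / n`!%:R * w t.

Definition moment {R : realType} (w : R -> R) (n : nat) : R :=
  \int[lebesgue_measure]_(t in (half_line R)) moment_integrand w n t.

Definition finite_moments {R : realType} (w : R -> R) : Prop :=
  forall n, lebesgue_measure.-integrable (half_line R)
    (EFin \o moment_integrand w n).

Definition damped {R : realType} (u : R -> R) (x t : R) : R :=
  expR (- (x * t)) * u t.

(** The hypotheses under which the Laplace integral of [u] converges on the whole
    open half-line. *)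
Definition laplace_density {R : realType} (u : R -> R) : Prop :=
  [/\ measurable_fun (half_line R) u,
      forall t : R, 0 < t -> 0 <= u t &
      forall x : R, 0 < x -> lebesgue_measure.-integrable
        (half_line R) (EFin \o damped u x)].

Lemma moment_integrandS {R : realType} (w : R -> R) n t :
  n.+1%:R * moment_integrand w n.+1 t = t * moment_integrand w n t.
Proof.
rewrite /moment_integrand factSr exprS; field.
by rewrite fact_neq0 nat1r pnatr_eq0.
Qed.

Lemma exprn_div_fact_le_expR {R : realType} (n : nat) (y : R) :
  0 <= y -> y ^+ n / n`!%:R <= expR y.
Proof.
case: n => [|n] y0.
  by rewrite expr0 fact0 divr1 -expR0 ler_expR.
by apply: le_trans (expR_ge1Dxn n y0); rewrite lerDr.
Qed.

Lemma measurable_moment_integrand {R : realType} (u : R -> R) (x : R) n :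
  measurable_fun (half_line R) u ->
  measurable_fun (half_line R) (moment_integrand (damped u x) n).
Proof.
move=> mu; apply: measurable_funM.
  apply: measurable_funM => //; exact: measurable_funX.
apply: measurable_funM => //.
by apply: measurableT_comp => //; exact: measurableT_comp.
Qed.

Lemma damped_finite_moments {R : realType} (u : R -> R) (x : R) :
  laplace_density u -> 0 < x -> finite_moments (damped u x).
Proof.
move=> [mu u0 iu] x0 n.
(* Half of the exponential factor absorbs the power of [t]. *)
have x20 : 0 < x / 2 by rewrite divr_gt0.
have iB : lebesgue_measure.-integrable (half_line R)
    (EFin \o (fun t => (2 / x) ^+ n * damped u (x / 2) t)).
  by apply: integrable_EFinZl => //; exact: iu.
apply: (le_integrable _ _ _ iB) => //.
- by apply/measurable_EFinP; exact: measurable_moment_integrand.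
- move=> t /=; rewrite in_itv/= andbT => t0.
  have ut := u0 t t0.
  rewrite lee_fin !ger0_norm; last 2 first.
  + by rewrite !mulr_ge0 ?expR_ge0 ?exprn_ge0// divr_ge0// ltW.
  + by rewrite !mulr_ge0 ?expR_ge0 ?exprn_ge0// ltW.
  rewrite /moment_integrand /damped !mulrA ler_wpM2r//.
  have -> : expR (- (x * t)) = expR (- (x / 2 * t)) * expR (- (x / 2 * t)).
    by rewrite -expRD; congr expR; field.
  rewrite mulrA ler_wpM2r ?expR_ge0//.
  rewrite expRN ler_pdivrMr ?expR_gt0//.
  rewrite (_ : t ^+ n / _ = (2 / x) ^+ n * ((x / 2 * t) ^+ n / n`!%:R)); last first.
    rewrite mulrA -exprMn; congr (_ ^+ _ / _); field.
    by rewrite gt_eqF.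
  rewrite ler_pM2l ?exprn_gt0 ?divr_gt0//.
  by apply: exprn_div_fact_le_expR; rewrite mulr_ge0 ?ltW.
Qed.

Lemma is_derive_damped_integrand {R : realType} (u : R -> R) n (x t : R) :
  is_derive x 1 (fun y => moment_integrand (damped u y) n t)
    (- (n.+1%:R * moment_integrand (damped u x) n.+1 t)).
Proof.
have dexp : is_derive x 1 (fun y => expR (- (y * t))) (- t * expR (- (x * t))).
  have -> : (fun y => expR (- (y * t))) = expR \o (fun y => - t * y).
    by apply/funext => y /=; rewrite mulNr mulrC.
  have dl : is_derive x 1 (fun y => - t * y) (- t).
    by rewrite -[X in is_derive _ _ _ X]mulr1; exact: is_deriveZ.
  have := is_derive1_comp (is_derive_expR _) dl.
  by rewrite (mulrC (expR _)) [X in expR X]mulNr (mulrC t x).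
rewrite moment_integrandS /moment_integrand.
have -> : (fun y => t ^+ n / n`!%:R * damped u y t) =
          (t ^+ n / n`!%:R * u t) \*: (fun y => expR (- (y * t))).
  by apply/funext => y; rewrite /damped mulrA mulrAC.
suff -> : - (t * (t ^+ n / n`!%:R * damped u x t)) =
          (t ^+ n / n`!%:R * u t) *: (- t * expR (- (x * t))) by exact: is_deriveZ.
by rewrite /damped /GRing.scale/=; ring.
Qed.

Lemma is_derive_moment {R : realType} (u : R -> R) n (x : R) :
  laplace_density u -> 0 < x ->
  is_derive x 1 (fun y => moment (damped u y) n)
    (- (n.+1%:R * moment (damped u x) n.+1)).
Proof.
move=> du x0; have [_ u0 _] := du.
have x20 : 0 < x / 2 by rewrite divr_gt0.
(* The derivative of the integrand decreases in absolute value, so on a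
   neighbourhood of [x] to the right of [x / 2] its value at [x / 2] dominates. *)
pose f y t := moment_integrand (damped u y) n t.
pose G t := `|n.+1%:R * moment_integrand (damped u (x / 2)) n.+1 t|.
have E y t : partial1of2 f y t = - (n.+1%:R * moment_integrand (damped u y) n.+1 t).
  by rewrite partial1of2E; have [_ ->] := is_derive_damped_integrand u n y t.
have I y : `]x / 2, x + 1[%classic y -> x / 2 < y by rewrite /= in_itv/= => /andP[].
have Ix : `]x / 2, x + 1[%classic x.
  by rewrite /= in_itv/= ltrDl ltr01 andbT ltr_pdivrMr// mulr_natr mulr2n ltrDl.
have intf y : `]x / 2, x + 1[%classic y ->
    lebesgue_measure.-integrable (half_line R) (EFin \o f y).
  by move=> /I yx; apply: damped_finite_moments => //; exact: lt_trans yx.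
have derf y t : `]x / 2, x + 1[%classic y -> (half_line R) t ->
    derivable (f^~ t) y 1.
  by move=> _ _; have [] := is_derive_damped_integrand u n y t.
have iS y : 0 < y -> lebesgue_measure.-integrable (half_line R)
    (EFin \o (fun t => n.+1%:R * moment_integrand (damped u y) n.+1 t)).
  by move=> y0; apply: integrable_EFinZl => //; exact: damped_finite_moments.
have intG : lebesgue_measure.-integrable (half_line R) (EFin \o G).
  exact: integrable_norm (iS _ x20).
have GE y t : `]x / 2, x + 1[%classic y -> (half_line R) t ->
    `|partial1of2 f y t| <= G t.
  move=> /I xy; rewrite /= in_itv/= andbT => t0.
  have ut := u0 t t0.
  rewrite E normrN /G !ger0_norm; last 2 first.
  - by rewrite !mulr_ge0 ?expR_ge0 ?exprn_ge0 ?invr_ge0// ltW.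
  - by rewrite !mulr_ge0 ?expR_ge0 ?exprn_ge0 ?invr_ge0// ltW.
  rewrite ler_wpM2l// ler_wpM2l//.
    by rewrite mulr_ge0 ?exprn_ge0 ?invr_ge0// ltW.
  by rewrite ler_wpM2r// ler_expR lerN2 ler_wpM2r// ltW.
have G0 t : 0 <= G t by exact: normr_ge0.
apply: DeriveDef.
  exact: (derivable_under_integral _ Ix intf derf G0 intG GE).
rewrite -derive1E.
rewrite (differentiation_under_integral _ Ix intf derf G0 intG GE)//.
rewrite /moment -RintegralZl//; last exact: damped_finite_moments.
rewrite -mulN1r -RintegralZl//; last exact: iS.
by apply: eq_Rintegral => t _; rewrite E mulN1r.
Qed.

Lemma integral_expR_pos {R : realType} (x : R) : 0 < x ->
  lebesgue_measure.-integrable (half_line R)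
    (EFin \o damped (fun=> 1) x) /\
  moment (damped (fun=> 1) x) 0 = x^-1.
Proof.
move=> x0.
have E (t : R) : 0 < t -> damped (fun=> 1) x t = x^-1 * exponential_pdf x t.
  move=> t0; rewrite exponential_pdfE ?ltW// /damped mulr1 mulKf ?gt_eqF//.
  by rewrite mulNr.
have iP := integrable_exponential_pdf x0.
have iP0 : lebesgue_measure.-integrable (half_line R)
    (EFin \o exponential_pdf x) by exact: integrableS iP.
split.
  have iZ := integrable_EFinZl lebesgue_measure _ x^-1 _ (measurable_itv _) iP0.
  apply: (eq_integrable _ _ _ _ iZ) => //.
  by move=> t; rewrite inE/= in_itv/= andbT => t0; rewrite E.
rewrite /moment.
transitivity (\int[lebesgue_measure]_(t in half_line R)
    (x^-1 * exponential_pdf x t)).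
  apply: eq_Rintegral => t; rewrite inE/= in_itv/= andbT => t0.
  by rewrite /moment_integrand expr0 fact0 divr1 mul1r E.
rewrite RintegralZl//.
rewrite Rintegral_itv_obnd_cbnd//.
rewrite /Rintegral.
suff -> : (\int[lebesgue_measure]_(t in (`[0%R, +oo[%classic : set R))
    (exponential_pdf x t)%:E = 1)%E by rewrite /= mulr1.
rewrite -(integral_exponential_pdf x0) integral_mkcond.
apply: eq_integral => t _; rewrite /restrict.
by case: ifPn => // tn; rewrite /exponential_pdf patchE (negbTE tn).
Qed.

Lemma laplace_density1 {R : realType} : laplace_density (fun=> 1 : R).
Proof.
split=> [|t _|x x0]; [exact: measurable_cst | exact: ler01 |].
exact: (integral_expR_pos _ x0).1.
Qed.

(** The Gamma integral at integers, obtained by differentiating the transform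
    [1 / x] of the constant 1. *)
Lemma moment_expR {R : realType} (n : nat) (x : R) :
  0 < x -> moment (damped (fun=> 1) x) n = x ^- n.+1.
Proof.
elim: n x => [|n IHn] x x0; first by rewrite (integral_expR_pos _ x0).2.
have n0 : n.+1%:R != 0 :> R by rewrite pnatr_eq0.
apply: (mulfI n0); apply: oppr_inj.
have [_ <-] := is_derive_moment _ n x laplace_density1 x0.
rewrite (near_eq_derive _ (near_eq_on_pos _ _ _ IHn x0)).
have xn0 : x ^+ n.+1 != 0 by rewrite expf_neq0// gt_eqF.
have dX : is_derive x 1 (fun y : R => y ^+ n.+1) (n.+1%:R * x ^+ n).
  apply: DeriveDef; first exact: exprn_derivable.
  by rewrite exp_derive /GRing.scale/= mulr1.
have [_ ->] := @is_deriveV _ (fun y => y ^+ n.+1) _ _ _ xn0 dX.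
rewrite /GRing.scale/= !exprS; field.
by rewrite expf_eq0 gt_eqF// andbF.
Qed.

(** * Inequalities between moments *)

(** Integrating [w] against a quadratic polynomial combines three consecutive
    moments; if the polynomial has the sign of [w] everywhere, the combination is
    nonnegative. All the inequalities between moments come from here. *)
Lemma moment_quadratic_ge0 {R : realType} (w : R -> R) (a b c : R) n :
  finite_moments w ->
  (forall t : R, 0 < t -> 0 <= (a + b * t + c * t ^+ 2) * w t) ->
  0 <= a * moment w n + b * (n.+1%:R * moment w n.+1) +
       c * (n.+2%:R * n.+1%:R * moment w n.+2).
Proof.
move=> iw w0.
pose I k := moment_integrand w k.
have iZ r k : lebesgue_measure.-integrable (half_line R)
    (EFin \o (fun t => r * I k t)).
  by apply: integrable_EFinZl => //; exact: iw.
have iD r s k l : lebesgue_measure.-integrable (half_line R)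
    (EFin \o (fun t => r * I k t + s * I l t)).
  have := integrableD _ (iZ r k) (iZ s l).
  rewrite (_ : (_ \+ _)%E = EFin \o (fun t => r * I k t + s * I l t)).
    by apply.
  by apply/funext => t; rewrite /= EFinD.
suff : 0 <= \int[lebesgue_measure]_(t in (half_line R))
    (a * I n t + (b * n.+1%:R) * I n.+1 t + (c * (n.+2%:R * n.+1%:R)) * I n.+2 t).
  rewrite RintegralD// RintegralD// !RintegralZl//; do ?exact: iw.
  by rewrite !mulrA.
apply: Rintegral_ge0 => t; rewrite /= in_itv/= andbT => t0.
have -> : a * I n t + (b * n.+1%:R) * I n.+1 t +
    (c * (n.+2%:R * n.+1%:R)) * I n.+2 t =
    t ^+ n / n`!%:R * ((a + b * t + c * t ^+ 2) * w t).
  have E1 : n.+1%:R * I n.+1 t = t * I n t := moment_integrandS w n t.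
  have E2 : n.+2%:R * I n.+2 t = t * I n.+1 t := moment_integrandS w n.+1 t.
  transitivity (a * I n t + b * (n.+1%:R * I n.+1 t) +
      c * (n.+1%:R * (n.+2%:R * I n.+2 t))); first by ring.
  rewrite E2 (mulrCA _ t (I n.+1 t)) E1.
  by rewrite /I /moment_integrand; ring.
by rewrite mulr_ge0 ?w0// divr_ge0// exprn_ge0// ltW.
Qed.

(** The moments of the subtracted exponential are explicit, so the parameters [A]
    and [c] give control over the moments of the difference. *)
Lemma finite_moments_subexp {R : realType} (u : R -> R) (x A c : R) :
  laplace_density u -> 0 < x -> 0 < c ->
  finite_moments (fun t => damped u x t - A * damped (fun=> 1) c t) /\
  forall n, moment (fun t => damped u x t - A * damped (fun=> 1) c t) n =
    moment (damped u x) n - A * c ^- n.+1.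
Proof.
move=> du x0 c0.
have iu := damped_finite_moments _ _ du x0.
have i1 := damped_finite_moments _ _ laplace_density1 c0.
have iA n : lebesgue_measure.-integrable (half_line R)
    (EFin \o (fun t => A * moment_integrand (damped (fun=> 1) c) n t)).
  by apply: integrable_EFinZl => //; exact: i1.
pose w t := damped u x t - A * damped (fun=> 1) c t.
have E n t : moment_integrand w n t = moment_integrand (damped u x) n t -
    A * moment_integrand (damped (fun=> 1) c) n t.
  by rewrite /moment_integrand /w; ring.
split=> n.
  have := integrableB _ (iu n) (iA n).
  rewrite (_ : (_ \- _)%E = EFin \o moment_integrand w n); first by apply.
  by apply/funext => t; rewrite /= E EFinB.
rewrite -moment_expR// /moment -RintegralZl// -RintegralB//.
by apply: eq_Rintegral => t _; exact: E.
Qed.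

(** The kernel [n.+1 - x * t] integrates to zero against
    [t ^+ n * expR (- (x * t))] and changes sign once, at [n.+1 / x]; a decreasing
    [u] puts more weight on its positive part. *)
Lemma moment_decreasing {R : realType} (u : R -> R) n (x : R) :
  laplace_density u -> {in `]0, +oo[ &, nonincreasing_fun u} -> 0 < x ->
  x * moment (damped u x) n.+1 <= moment (damped u x) n.
Proof.
move=> du ud x0; pose t0 := n.+1%:R / x.
have t00 : 0 < t0 by rewrite divr_gt0.
have [iw Ew] := finite_moments_subexp u x (u t0) x du x0 x0.
have := moment_quadratic_ge0 _ t0 (-1) 0 n iw.
rewrite !Ew => H.
(* For [u = 1] the two sides agree, so the terms in [u t0] cancel. *)
suff wt : forall t : R, 0 < t -> 0 <= (t0 + -1 * t + 0 * t ^+ 2) *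
    (damped u x t - u t0 * damped (fun=> 1) x t).
  move: {H}(H wt) => H; rewrite -subr_ge0.
  have xn0 : x ^+ n.+1 != 0 by rewrite expf_neq0// gt_eqF.
  have -> : moment (damped u x) n - x * moment (damped u x) n.+1 =
    x / n.+1%:R * (t0 * (moment (damped u x) n - u t0 / x ^+ n.+1) +
    -1 * (n.+1%:R * (moment (damped u x) n.+1 - u t0 / x ^+ n.+2)) +
     0 * (n.+2%:R * n.+1%:R * (moment (damped u x) n.+2 - u t0 / x ^+ n.+3))).
    rewrite /t0 mul0r addr0 !exprS; field.
    by rewrite nat1r pnatr_eq0 expf_eq0 !gt_eqF// andbF.
  by rewrite mulr_ge0// divr_ge0// ltW.
move=> t tp; rewrite mul0r addr0 mulN1r.
have -> : damped u x t - u t0 * damped (fun=> 1) x t =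
    expR (- (x * t)) * (u t - u t0).
  by rewrite /damped; ring.
rewrite mulrCA mulr_ge0 ?expR_ge0//.
have inP (y : R) : 0 < y -> y \in `]0, +oo[ by rewrite in_itv/= andbT.
have [tt|/ltW tt] := leP t t0.
  by rewrite mulr_ge0 ?subr_ge0// ud ?inP.
by rewrite mulr_le0 ?subr_le0// ud ?inP.
Qed.

(** A function whose negativity set is order-convex has the sign pattern of a
    polynomial of degree at most two: no change, one change at [a], or two
    changes at [a] and [b]. *)
Lemma sign_pattern {R : realType} (w : R -> R) :
  (forall s t r : R, 0 < s -> s < t -> t < r -> w s < 0 -> w r < 0 -> w t < 0) ->
  [\/ forall t : R, 0 < t -> 0 <= w t,
      exists2 a : R, 0 <= a & forall t : R, 0 < t -> 0 <= (a - t) * w t |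
      exists a b : R, [/\ 0 <= a, 0 < b &
        forall t : R, 0 < t -> 0 <= (t - a) * (t - b) * w t]].
Proof.
move=> wc; pose S := [set t : R | 0 < t /\ w t < 0].
have wS (t : R) : 0 < t -> ~ S t -> 0 <= w t.
  by move=> t0 nS; rewrite leNgt; apply/negP => wt; exact: nS.
have [S0|/set0P Sn0] := eqVneq S set0.
  by apply: Or31 => t t0; apply: wS => //; rewrite S0.
have lS : lbound S 0 by move=> t [/ltW].
have hlS : has_lbound S by exists 0.
have a0 : 0 <= inf S by exact: lb_le_inf.
have below (t : R) : 0 < t -> t < inf S -> 0 <= w t.
  move=> t0 ta; apply: wS => // St; move: ta; rewrite ltNge => /negP; apply.
  exact: ge_inf.
have between (t r : R) : inf S < t -> t < r -> S r -> w t < 0.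
  move=> ta tr [_ wr]; have [s [s0 ws] st] := inf_lt Sn0 ta.
  exact: wc s0 st tr ws wr.
(* The negativity set is an interval with end points [inf S] and [sup S]. *)
have [hu|nhu] := pselect (has_ubound S); last first.
  apply: Or32; exists (inf S) => // t t0.
  have [ta|ta|->] := ltgtP t (inf S); last by rewrite subrr mul0r.
    by rewrite mulr_ge0// ?below// subr_ge0 ltW.
  have [r Sr tr] : exists2 r, S r & t < r.
    apply: contrapT => H; apply: nhu; exists t => r Sr.
    by rewrite leNgt; apply/negP => tr; apply: H; exists r.
  by rewrite mulr_le0// ?subr_le0 ltW// (between t r).
have ab : inf S <= sup S.
  by have [s Ss] := Sn0; exact: le_trans (ge_inf hlS Ss) (ub_le_sup hu Ss).
apply: Or33; exists (inf S), (sup S); split=> //.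
  by have [s Ss] := Sn0; apply: lt_le_trans (ub_le_sup hu Ss); case: Ss.
move=> t t0; have [ta|ta|->] := ltgtP t (inf S); last by rewrite subrr !mul0r.
  rewrite mulr_ge0 ?below// -mulrNN mulr_ge0// oppr_ge0 subr_le0 ltW//.
  exact: lt_le_trans ab.
have [tb|tb|->] := ltgtP t (sup S); last by rewrite subrr mulr0 mul0r.
  have [r Sr tr] := sup_gt Sn0 tb.
  rewrite mulr_le0// ?(ltW (between _ _ ta tr Sr))//.
  by rewrite mulr_ge0_le0// ?subr_ge0 ?subr_le0 ltW.
rewrite mulr_ge0 ?mulr_ge0 ?subr_ge0 ?(ltW ta) ?(ltW tb)//.
apply: wS => // St; move: tb; rewrite ltNge => /negP; apply.
exact: ub_le_sup.
Qed.

(** The logarithm of an exponential is affine, so a convex logarithm below it at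
    two points is below it in between. *)
Lemma log_convex_lt_expR {R : realType} (u : R -> R) (A c s t r : R) :
  positive_on_pos u -> log_convex_on_pos u -> 0 < A ->
  0 < s -> s < t -> t < r ->
  u s < A * expR (- (c * s)) -> u r < A * expR (- (c * r)) ->
  u t < A * expR (- (c * t)).
Proof.
move=> u0 uc A0 s0 st tr us ur.
have t0 := lt_trans s0 st; have r0 := lt_trans t0 tr.
have rs : 0 < r - s by rewrite subr_gt0 (lt_trans st).
pose l := (r - t) / (r - s).
have l0 : 0 < l by rewrite divr_gt0// subr_gt0.
have l1 : l < 1 by rewrite ltr_pdivrMr// mul1r ltrD2l ltrN2.
have lnE (y : R) : A * expR (- (c * y)) = expR (ln A - c * y).
  by rewrite expRD lnK ?posrE.
have lnu (y : R) : 0 < y -> u y < A * expR (- (c * y)) -> ln (u y) < ln A - c * y.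
  move=> y0 uy; rewrite -ltr_expR lnK ?posrE ?u0// -lnE//.
have Et : t = l * s + (1 - l) * r.
  by rewrite /l; field; rewrite gt_eqF.
rewrite lnE -[ltLHS]lnK ?posrE ?u0// ltr_expR.
have s_in : s \in (half_line R) by rewrite inE/= in_itv/= s0.
have r_in : r \in (half_line R) by rewrite inE/= in_itv/= r0.
have : ln (u t) <= l * ln (u s) + (1 - l) * ln (u r).
  by rewrite {1}Et; exact: (uc (Itv01 (ltW l0) (ltW l1)) s r s_in r_in).
move=> /le_lt_trans; apply.
rewrite [ltRHS](_ : _ = l * (ln A - c * s) + (1 - l) * (ln A - c * r)).
  by rewrite ltrD// ltr_pM2l ?lnu// subr_gt0.
by rewrite {1}Et; ring.
Qed.

(** If the inequality failed at [n], some exponential [A * expR (- (c * t))] would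
    have the same moment of order [n] as the damped [u], a smaller one of order
    [n.+1] and a larger one of order [n.+2]. But by log-convexity the set where
    the difference is negative is order-convex, so a polynomial of degree at most
    two has the same sign as the difference and contradicts these moments. *)
Lemma moment_log_convex {R : realType} (u : R -> R) n (x : R) :
  laplace_density u -> positive_on_pos u -> log_convex_on_pos u -> 0 < x ->
  (forall k, 0 < moment (damped u x) k) ->
  moment (damped u x) n.+1 ^+ 2 <=
  moment (damped u x) n * moment (damped u x) n.+2.
Proof.
move=> du u0 uc x0 m_gt0; rewrite leNgt; apply/negP => bad.
pose m := moment (damped u x); rewrite -/m in m_gt0 bad.
pose p := m n / m n.+1; pose q := m n.+1 / m n.+2.
have mn := m_gt0 n; have mn1 := m_gt0 n.+1; have mn2 := m_gt0 n.+2.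
have p0 : 0 < p by rewrite divr_gt0.
have q0 : 0 < q by rewrite divr_gt0.
have pq : p < q by rewrite /p /q ltr_pdivrMr// mulrAC ltr_pdivlMr// -expr2.
have mp : m n / m n.+1 = p by [].
have mpq : m n / m n.+2 = p * q by rewrite /p /q mulrA divfK// gt_eqF.
clearbody p q.
(* Any number strictly between [p] and the square root of [p * q] would do; the
   harmonic mean is such a number without being a root. *)
pose c := 2 * p * q / (p + q).
have pq0 : 0 < p + q by rewrite addr_gt0.
have c0 : 0 < c by rewrite divr_gt0// !mulr_gt0.
have pc : p < c.
  rewrite /c ltr_pdivlMr// -subr_gt0.
  by rewrite (_ : _ - _ = p * (q - p)) ?mulr_gt0 ?subr_gt0//; ring.
have cc : c ^+ 2 < p * q.
  rewrite /c expr_div_n ltr_pdivrMr ?exprn_gt0// -subr_gt0.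
  rewrite (_ : _ - _ = p * q * (q - p) ^+ 2); last by ring.
  by apply: mulr_gt0; [exact: mulr_gt0 | rewrite exprn_gt0// subr_gt0].
pose A := m n * c ^+ n.+1.
have A0 : 0 < A by rewrite mulr_gt0// exprn_gt0.
have [iw Ew] := finite_moments_subexp u x A c du x0 c0.
set w := (fun t => _) in iw Ew; rewrite -/m in Ew.
have cn0 : c ^+ n.+1 != 0 by rewrite expf_neq0// gt_eqF.
have y0 : moment w n = 0 by rewrite Ew /A mulfK// subrr.
have y1 : 0 < moment w n.+1.
  rewrite Ew /A [c ^+ n.+2]exprSr invfM mulrA mulfK// subr_gt0.
  by rewrite ltr_pdivrMr// mulrC -ltr_pdivrMr// mp.
have y2 : moment w n.+2 < 0.
  rewrite Ew /A -[n.+3]addn2 exprD invfM mulrA mulfK// subr_lt0.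
  rewrite ltr_pdivlMr ?exprn_gt0// mulrC -ltr_pdivlMr//.
  by rewrite mpq.
(* The moments of [w] of orders [n], [n.+1], [n.+2] are zero, positive and
   negative, which none of the three cases of [sign_pattern] allows. *)
have wE (t : R) : (w t < 0) = (u t < A * expR (- ((c - x) * t))).
  rewrite /w /damped mulr1 subr_lt0 mulrC -ltr_pdivlMr ?expR_gt0//.
  by rewrite -mulrA -expRN -expRD; congr (_ < _ * expR _); ring.
have wc (s t r : R) : 0 < s -> s < t -> t < r -> w s < 0 -> w r < 0 -> w t < 0.
  by move=> s0 st tr; rewrite !wE; exact: log_convex_lt_expR.
have [w0|[a a0 w0]|[a [b [a0 b0 w0]]]] := sign_pattern w wc.
- have := moment_quadratic_ge0 _ 1 0 0 n.+2 iw.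
  rewrite mul1r !mul0r !addr0 leNgt y2 => H; suff : false by []; apply: H => t t0.
  by rewrite !mul0r !addr0 mul1r w0.
- have := moment_quadratic_ge0 _ a (-1) 0 n iw.
  rewrite y0 mulr0 mul0r add0r addr0 mulN1r oppr_ge0 leNgt pmulr_rgt0// y1.
  move=> H; suff : false by []; apply: H => t t0.
  by rewrite mul0r addr0 mulN1r w0.
- have := moment_quadratic_ge0 _ (a * b) (- (a + b)) 1 n iw.
  rewrite y0 mulr0 add0r mul1r => H.
  have /H {H} : forall t : R, 0 < t ->
      0 <= (a * b + - (a + b) * t + 1 * t ^+ 2) * w t.
    move=> t t0; rewrite (_ : a * b + _ + _ = (t - a) * (t - b)); last by ring.
    exact: w0.
  rewrite leNgt => /negP; apply; rewrite mulNr addrC subr_lt0.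
  apply: (@lt_trans _ _ 0); first by rewrite pmulr_rlt0 ?mulr_gt0.
  by rewrite mulr_gt0 ?ltr_wpDl// mulr_gt0.
Qed.

(** * Laplace transforms of decreasing functions *)

(** The superlevel sets are intervals. *)
Lemma nonincreasing_measurable_pos {R : realType} (u : R -> R) :
  {in `]0, +oo[ &, nonincreasing_fun u} ->
  measurable_fun (half_line R) u.
Proof.
move=> ud; apply: (measurability (@RGenCInfty.G R)) => [|/= _ [_] [r] -> <-].
  exact: RGenCInfty.measurableE.
apply: is_interval_measurable => s t/=.
rewrite !in_itv/= !andbT => -[s0 us] [t0 ut] v /andP[sv vt].
have v0 := lt_le_trans s0 sv; split; rewrite in_itv/= andbT//.
by rewrite (le_trans ut)// ud// in_itv/= andbT.
Qed.

(** An identity with real values in the extended reals contains the convergence of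
    the integral. *)
Lemma laplace_density_of_finite {R : realType} (u F : R -> R) :
  positive_on_pos u -> {in `]0, +oo[ &, nonincreasing_fun u} ->
  (forall x : R, 0 < x -> (F x)%:E = laplace u x) ->
  laplace_density u /\ forall x : R, 0 < x -> moment (damped u x) 0 = F x.
Proof.
move=> u0 ud FE.
have mu := nonincreasing_measurable_pos _ ud.
split.
  split=> // [t t0|x x0]; first by rewrite ltW// u0.
  apply/integrableP; split.
    apply/measurable_EFinP; apply: measurable_funM => //.
    by apply: measurableT_comp => //; exact: measurableT_comp.
  rewrite (_ : integral _ _ _ = (F x)%:E) ?ltry// FE// /laplace.
  apply: eq_integral => t; rewrite inE/= in_itv/= andbT => t0.
  by rewrite ger0_norm// /damped mulr_ge0 ?expR_ge0// ltW// u0.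
move=> x x0; apply: EFin_inj; rewrite FE// /laplace /moment /Rintegral.
rewrite fineK.
  by apply: eq_integral => t _; rewrite /moment_integrand expr0 fact0 divr1 mul1r.
rewrite (_ : integral _ _ _ = (F x)%:E)// FE// /laplace.
by apply: eq_integral => t _; rewrite /moment_integrand expr0 fact0 divr1 mul1r.
Qed.

Lemma moment_gt0 {R : realType} (u : R -> R) n (x : R) :
  laplace_density u -> positive_on_pos u ->
  {in `]0, +oo[ &, nonincreasing_fun u} -> 0 < x -> 0 < moment (damped u x) n.
Proof.
move=> du u0 ud x0.
have iw := damped_finite_moments _ _ du x0 n.
(* [c] bounds the integrand from below on [1, 2], an interval of length 1. *)
pose c := n`!%:R^-1 * (expR (- (x * 2)) * u 2).
have c0 : 0 < c.
  by rewrite !mulr_gt0 ?expR_gt0 ?u0// invr_gt0 ltr0n fact_gt0.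
apply: (lt_le_trans c0).
rewrite -lee_fin /moment /Rintegral fineK; last exact: integrable_fin_num.
have sub : (`[1%R, 2%R]%classic : set R) `<=` `]0%R, +oo[%classic.
  move=> t /=; rewrite !in_itv/= => /andP[t1 _].
  by rewrite (lt_le_trans ltr01).
have mw := measurable_int _ iw.
apply: (@le_trans _ _
    (\int[lebesgue_measure]_(t in (`[1%R, 2%R]%classic : set R)) c%:E)%E).
  rewrite integral_cst//= lebesgue_measure_itv/= lte_fin ltr1n/= -EFinB.
  by rewrite (_ : 2 - 1 = 1 :> R) ?mule1//; ring.
apply: (@le_trans _ _ (\int[lebesgue_measure]_(t in (`[1%R, 2%R]%classic : set R))
    (moment_integrand (damped u x) n t)%:E)%E).
  apply: ge0_le_integral => //.
  - by move=> t _; rewrite lee_fin ltW.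
  - by apply: measurable_funS mw.
  move=> t /=; rewrite in_itv/= => /andP[t1 t2]; rewrite lee_fin.
  have t0 : 0 < t by exact: lt_le_trans t1.
  rewrite /c /moment_integrand /damped ler_pM ?invr_ge0//.
  + by rewrite mulr_ge0 ?expR_ge0// ltW// u0.
  + by rewrite ler_peMl ?invr_ge0// exprn_ege1.
  rewrite ler_pM ?expR_ge0// ?(ltW (u0 _ _))//.
    by rewrite ler_expR lerN2 ler_pM2l.
  by rewrite ud// in_itv/= andbT.
apply: ge0_subset_integral => // t /=; rewrite in_itv/= andbT => t0.
by rewrite lee_fin !mulr_ge0 ?expR_ge0 ?exprn_ge0 ?invr_ge0// ltW// u0.
Qed.

Theorem proposition5p11 (R : realType) (alpha : R) (f : R -> R)
    (alpha_ge0 : 0 <= alpha) (fC : class_C alpha f) :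
  [/\ generalized_Bernstein 1 (fun x : R => x `^ (alpha + 1) * f x),
      generalized_Bernstein (alpha + 1) (fun x : R => (f x)^-1) &
      completely_monotonic (fun x : R => (x `^ (alpha + 1) * f x)^-1)].
Proof.
have [f0 [u [u0 ud uc fE]]] := fC.
have [du gE] := laplace_density_of_finite u (fun x => x `^ alpha * f x) u0 ud fE.
pose D n x := moment (damped u x) n.
have dD n (x : R) : 0 < x -> is_derive x 1 (D n) (- (n.+1%:R * D n.+1 x)).
  by move=> x0; exact: is_derive_moment.
have D_gt0 n (x : R) : 0 < x -> 0 < D n x by move=> x0; exact: moment_gt0.
have [sg tg] := tcoef_of_tower (D 0%N) D (fun _ _ => erefl) dD.
have [sp tp] := tcoef_mulx_tower D dD.
have pE (x : R) : 0 < x -> x * D 0%N x = x `^ (alpha + 1) * f x.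
  move=> x0; rewrite /D gE// powRD; last by rewrite (gt_eqF x0) implybT.
  by rewrite powRr1 ?ltW//; ring.
set p := (fun x => x * D 0%N x) in sp tp pE.
pose F x := x `^ (alpha + 1) * f x.
have pN n (x : R) : 0 < x -> tcoef p n.+1 x <= 0.
  by move=> x0; rewrite tp// subr_le0; exact: moment_decreasing.
have p0 : positive_on_pos p by move=> x x0; rewrite mulr_gt0 ?D_gt0.
have cp : completely_monotonic (fun x => (p x)^-1).
  exact: completely_monotonic_inverse p0 sp pN.
split.
- split.
  + by move=> x x0; rewrite -pE// p0.
  + exact: (eq_smooth_on_pos _ _ pE sp).
  apply: (eq_completely_monotonic p^`()%classic); last first.
    exact: (completely_monotonic_derive1P _ sp pN).
  by move=> x x0; rewrite subrr powRr0 mul1r (eq_derive1_on_pos _ _ pE).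
- have gn0 (x : R) : 0 < x -> D 0%N x != 0 by move=> x0; rewrite gt_eqF// D_gt0.
  have sV := smooth_on_posV _ gn0 sg.
  have hE (x : R) : 0 < x -> x `^ alpha * (D 0%N x)^-1 = (f x)^-1.
    by move=> x0; rewrite /D gE// invfM mulrA mulfV ?mul1r// gt_eqF// powR_gt0.
  have sh := smooth_on_posM _ _ (smooth_on_pos_powR alpha) sV.
  split.
  + by move=> x x0; rewrite invr_gt0 f0.
  + exact: (eq_smooth_on_pos _ _ hE sh).
  apply: (eq_completely_monotonic
    (fun x => alpha * (p x)^-1 + (fun y => (D 0%N y)^-1)^`()%classic x)); last first.
    apply: completely_monotonicD.
      have ca := completely_monotonic_cst _ alpha_ge0.
      exact: (completely_monotonicM _ _ ca cp).
    apply: (completely_monotonic_derive1P _ sV) => n x x0.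
    apply: (tcoef_inverse_log_convex_le0 (D 0%N) n x) => //.
    * by move=> y y0; exact: D_gt0.
    * by move=> k; rewrite tg// D_gt0.
    move=> k; rewrite !tg//; apply: moment_log_convex => // j; exact: D_gt0.
  move=> x x0; rewrite -(eq_derive1_on_pos _ _ hE x x0).
  have dP := is_derive1_powR alpha x0.
  have dV := smooth_upto_is_derive 0 _ ((smooth_onP _).1 sV 0%N) x x0.
  have [_ dE] := is_deriveM dP dV.
  rewrite [X in _ = _ * X]derive1E [X in _ = _ * X]dE /GRing.scale/=.
  have E0 : x `^ (1 - (alpha + 1)) * x `^ alpha = 1.
    rewrite -powRD; last by rewrite (gt_eqF x0) implybT.
    by rewrite (_ : 1 - (alpha + 1) + alpha = 0) ?powRr0//; ring.
  have E1 : x `^ (1 - (alpha + 1)) * x `^ (alpha - 1) = x^-1.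
    rewrite -powRD; last by rewrite (gt_eqF x0) implybT.
    by rewrite (_ : 1 - (alpha + 1) + (alpha - 1) = -1) ?powR_inv1 ?ltW//; ring.
  set d := (X in _ + X = _).
  transitivity ((x `^ (1 - (alpha + 1)) * x `^ alpha) * d +
    alpha * ((x `^ (1 - (alpha + 1)) * x `^ (alpha - 1)) * (D 0%N x)^-1)).
    by rewrite E0 E1 /p invfM; ring.
  by rewrite -/d; move: d (_ `^ _) (_ `^ _) (_ `^ _) (D 0%N x)^-1 => *; ring.
- by apply: eq_completely_monotonic cp => x x0; rewrite -pE.
Qed.
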